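(* Let $\Sigma$ be an alphabet and $\langle\Sigma\rangle$ the free group on $\Sigma$. An element of $\langle\Sigma\rangle$ is a product (in the group) of at most two palindromes if and only if its reduced form is equal, as a concatenation of words (i.e. with no cancellation performed), to $$A\,P\,Q\,A^{-1}$$ for some (possibly empty) palindromes $P, Q$ and some (possibly empty) word $A$.
   Context: Let $\Sigma_g=\Sigma\cup\{a^{-1} : a\in\Sigma\}$. Elements of $\langle\Sigma\rangle$ are represented by their reduced forms, i.e. words over $\Sigma_g$ in which no letter $a$ is adjacent to $a^{-1}$. For a word $X=x_1x_2\cdots x_n$ with $x_i\in\Sigma_g$, the mirror image is $\overline{X}=x_n\cdots x_2x_1$, and the inverse is $X^{-1}=x_n^{-1}\cdots x_1^{-1}$ with $(a^{-1})^{-1}=a$. A palindrome is a word $P$ with $P=\overline{P}$; the empty word is a palindrome. An element of $\langle\Sigma\rangle$ is called a palindrome if its reduced form is a palindrome. ''The reduced form is a concatenation of the form $W_1W_2\cdots W_m$'' means that the reduced word equals the literal concatenation of the words $W_1,\dots,W_m$ over $\Sigma_g$ (so this concatenation is itself reduced). *)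

(* Defs.v *)
From HB Require Import structures.
From mathcomp Require Import all_boot all_fingroup.

Set Implicit Arguments.
Unset Strict Implicit.
Unset Printing Implicit Defensive.

Local Open Scope group_scope.

(* (a, false) stands for a, and (a, true) for the formal inverse of a. *)
Notation letter Sigma := (Sigma * bool)%type.
Notation word Sigma := (seq (letter Sigma)).

Definition linv (Sigma : choiceType) (x : letter Sigma) : letter Sigma :=
  (x.1, ~~ x.2).

(* The mirror image is [rev w]; [winv w] also inverts each letter. *)
Definition winv (Sigma : choiceType) (w : word Sigma) : word Sigma :=
  rev (map (@linv Sigma) w).

Definition palindrome (Sigma : choiceType) (w : word Sigma) : bool :=
  w == rev w.

Definition reduced (Sigma : choiceType) (w : word Sigma) : bool :=
  sorted (fun x y => y != linv x) w.

Definition push (Sigma : choiceType) (x : letter Sigma) (w : word Sigma) :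
    word Sigma :=
  if w is y :: w' then if y == linv x then w' else x :: w else [:: x].

Definition reduce (Sigma : choiceType) (w : word Sigma) : word Sigma :=
  foldr (@push Sigma) [::] w.

(* A group element is identified with its reduced form; [fg_liftM],
   [fg_lift_gen] and [fg_lift_unique] establish the universal property. *)
Record free_group (Sigma : choiceType) : Type :=
  FreeGroup { rform : word Sigma; rform_reduced : reduced rform }.

HB.instance Definition _ (Sigma : choiceType) :=
  [isSub for @rform Sigma].
HB.instance Definition _ (Sigma : choiceType) :=
  [Choice of free_group Sigma by <:].

Section Group.
Variable Sigma : choiceType.
Implicit Types (x : letter Sigma) (u v w : word Sigma) (g h : free_group Sigma).

Lemma linvK : involutive (@linv Sigma).
Proof. by case=> a b; rewrite /linv /= negbK. Qed.

Lemma reduced_behead x w : reduced (x :: w) -> reduced w.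
Proof. exact: path_sorted. Qed.

Lemma push_reduced x w : reduced w -> reduced (push x w).
Proof.
case: w => [//|y w] rw; rewrite /push; case: ifP => [_|ny].
  exact: reduced_behead rw.
by rewrite /reduced /= ny.
Qed.

Lemma reduce_reduced w : reduced (reduce w).
Proof. by elim: w => [//|x w]; apply: push_reduced. Qed.

Lemma reduce_id w : reduced w -> reduce w = w.
Proof.
elim: w => [//|x w IHw] rxw /=; rewrite IHw; last exact: reduced_behead rxw.
by case: w rxw {IHw} => [//|y w] /= /andP[/negPf->].
Qed.

Lemma pushK x w : reduced w -> push x (push (linv x) w) = w.
Proof.
case: w => [|y w] /=; first by rewrite eqxx.
rewrite linvK; case: eqP => [->|_ _]; last by rewrite /= eqxx.
by case: w => [//|z w] /= /andP[/negPf->].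
Qed.

Lemma reduce_push x u v : reduce (push x u ++ v) = push x (reduce (u ++ v)).
Proof.
case: u => [//|y u] /=; case: eqP => [->|_] //.
by rewrite pushK ?reduce_reduced.
Qed.

Lemma reduce_catl u v : reduce (reduce u ++ v) = reduce (u ++ v).
Proof. by elim: u => [//|x u IHu] /=; rewrite reduce_push IHu. Qed.

Lemma reduce_catr u v : reduce (u ++ reduce v) = reduce (u ++ v).
Proof.
by elim: u => [|x u IHu] /=; [exact: reduce_id (reduce_reduced v)|rewrite IHu].
Qed.

Lemma winv_cons x u : winv (x :: u) = rcons (winv u) (linv x).
Proof. by rewrite /winv /= rev_cons. Qed.

Lemma winvK : involutive (@winv Sigma).
Proof. by move=> u; rewrite /winv map_rev revK mapK //; apply: linvK. Qed.

Lemma winv_reduced w : reduced w -> reduced (winv w).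
Proof.
rewrite /reduced /winv rev_sorted sorted_map.
by apply: sub_sorted => x y /= nyx; rewrite linvK eq_sym.
Qed.

Lemma reduce_winvr w : reduce (w ++ winv w) = [::].
Proof.
elim: w => [//|x w IHw].
rewrite winv_cons -cats1 /= catA -reduce_catl IHw /=.
by rewrite eqxx.
Qed.

Lemma reduce_winvl w : reduce (winv w ++ w) = [::].
Proof. by rewrite -[w in _ ++ w]winvK reduce_winvr. Qed.

Definition fg_one := @FreeGroup Sigma [::] isT.
Definition fg_mul g h := FreeGroup (reduce_reduced (rform g ++ rform h)).
Definition fg_inv g := FreeGroup (winv_reduced (rform_reduced g)).

Fact fg_mulA : associative fg_mul.
Proof.
by move=> g h k; apply: val_inj; rewrite /= reduce_catr reduce_catl catA.
Qed.

Fact fg_mul1 : left_id fg_one fg_mul.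
Proof. by move=> g; apply: val_inj; apply: reduce_id (rform_reduced g). Qed.

Fact fg_mulr1 : right_id fg_one fg_mul.
Proof.
by move=> g; apply: val_inj; rewrite /= cats0 reduce_id ?rform_reduced.
Qed.

Fact fg_mulV : left_inverse fg_one fg_inv fg_mul.
Proof. by move=> g; apply: val_inj; apply: reduce_winvl. Qed.

Fact fg_mulrV : right_inverse fg_one fg_inv fg_mul.
Proof. by move=> g; apply: val_inj; apply: reduce_winvr. Qed.

HB.instance Definition _ :=
  isGroup.Build (free_group Sigma) fg_mulA fg_mul1 fg_mulr1 fg_mulV fg_mulrV.

Definition fg_gen (a : Sigma) := @FreeGroup Sigma [:: (a, false)] isT.

End Group.

Section UniversalProperty.
Variables (Sigma : choiceType) (G : groupType) (f : Sigma -> G).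

Definition letter_val (x : letter Sigma) : G :=
  if x.2 then (f x.1)^-1 else f x.1.

Definition word_val (w : word Sigma) : G :=
  foldr (fun x z => letter_val x * z) 1 w.

Definition fg_lift (g : free_group Sigma) : G := word_val (rform g).

Lemma letter_val_linv x : letter_val (linv x) = (letter_val x)^-1.
Proof. by case: x => a [] //=; rewrite /letter_val /= invgK. Qed.

Lemma word_val_cat u v : word_val (u ++ v) = word_val u * word_val v.
Proof. by elim: u => [|x u IHu] /=; rewrite ?mul1g // IHu mulgA. Qed.

Lemma word_val_reduce w : word_val (reduce w) = word_val w.
Proof.
elim: w => [//|x w /= <-]; case: (reduce w) => [//|y u] /=.
by case: eqP => [->|//]; rewrite letter_val_linv mulVKg.
Qed.

Lemma fg_liftM : {morph fg_lift : g h / g * h}.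
Proof. by move=> g h; rewrite /fg_lift /= word_val_reduce word_val_cat. Qed.

Lemma fg_lift_gen a : fg_lift (fg_gen a) = f a.
Proof. exact: mulg1. Qed.

Lemma fg_lift_unique (phi : free_group Sigma -> G) :
  {morph phi : g h / g * h} -> (forall a, phi (fg_gen a) = f a) ->
  phi =1 fg_lift.
Proof.
move=> phiM phi_gen.
have phi1 : phi 1 = 1 by apply: (mulgI (phi 1)); rewrite -phiM !mulg1.
have phiV g : phi g^-1 = (phi g)^-1.
  by apply: (mulgI (phi g)); rewrite -phiM !mulgV.
case=> w rw; rewrite /fg_lift /=.
elim: w rw => [|x w IHw] rw.
  by rewrite /= -[RHS]phi1; apply: (congr1 phi); apply: val_inj.
have rw' := reduced_behead rw.
pose gx := @FreeGroup Sigma [:: x] isT.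
have -> : FreeGroup rw = gx * FreeGroup rw'.
  by apply: val_inj; rewrite /= -[LHS](reduce_id rw).
rewrite phiM IHw /=; congr (_ * _).
have [a [b]] : exists a b, x = (a, b) by case: x {rw gx} => a b; exists a, b.
rewrite /gx => ->; case: b; last exact: phi_gen.
transitivity (phi (fg_gen a)^-1); last by rewrite phiV phi_gen.
by apply: (congr1 phi); apply: val_inj.
Qed.

End UniversalProperty.

Definition palindromic (Sigma : choiceType) (g : free_group Sigma) : bool :=
  palindrome (rform g).

(* Main.v *)
(* Cancelling C in a product of reduced palindromes p = X C and q = C^-1 Y
   leaves the reduced form X Y; taking inverses we may assume |Y| <= |X|.
   If |C| <= |Y|, then p = rev C P C and q = C^-1 Q (rev C)^-1, so that
   X Y = rev C P Q (rev C)^-1.  Otherwise q = rev Y M Y, which forces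
   X = Y^-1 Z with both M^-1 and Z M^-1 palindromes; by a periodicity argument
   Z is then a concatenation of two palindromes.  Conversely
   A P Q A^-1 = (A P rev A) ((rev A)^-1 Q A^-1), and reduction commutes with
   the mirror image. *)
Require Import Defs.
From mathcomp Require Import all_boot all_fingroup.

Set Implicit Arguments.
Unset Strict Implicit.
Unset Printing Implicit Defensive.

Section Words.
Variable Sigma : choiceType.
Implicit Types (x : letter Sigma) (u v w : word Sigma).
Implicit Types (A C M N P Q R X Y Z p q : word Sigma).

Lemma winv_cat u v : winv (u ++ v) = winv v ++ winv u.
Proof. by rewrite /winv map_cat rev_cat. Qed.

Lemma winv_rev u : winv (rev u) = rev (winv u).
Proof. by rewrite /winv map_rev. Qed.

Lemma size_winv u : size (winv u) = size u.
Proof. by rewrite /winv size_rev size_map. Qed.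

Lemma palindrome_winv P : palindrome P -> palindrome (winv P).
Proof. by move=> /eqP eP; rewrite /palindrome -winv_rev -eP. Qed.

Lemma palindrome_cat_rev A P : palindrome P -> palindrome (A ++ P ++ rev A).
Proof. by move=> /eqP eP; rewrite /palindrome !rev_cat revK -eP catA. Qed.

Lemma reduced_rev w : reduced (rev w) = reduced w.
Proof.
rewrite /reduced rev_sorted; apply: eq_sorted => x y /=.
by rewrite [in RHS]eq_sym (can2_eq (@linvK Sigma) (@linvK Sigma)).
Qed.

(** [reduce] pushes letters at the front, while mirroring moves [x] to the end: there it either
    cancels the last letter of the mirrored reduced word or extends it to a reduced word. *)
Lemma reduce_rev w : reduce (rev w) = rev (reduce w).
Proof.
elim: w => [//|x w IHw].
rewrite rev_cons -cats1 -reduce_catl IHw /=.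
have := reduce_reduced w; case: (reduce w) => [//|y u] ru /=.
case: (y =P linv x) ru => [->|/eqP nyx] ru.
  rewrite rev_cons -cats1 -catA -reduce_catr /= linvK eqxx cats0.
  by rewrite reduce_id // reduced_rev; apply: reduced_behead ru.
rewrite -[RHS]reduce_id; first by rewrite [in RHS]rev_cons cats1.
by rewrite reduced_rev /reduced /= nyx.
Qed.

Lemma reduce_cat_nil u v w :
  reduce v = [::] -> reduce (u ++ v ++ w) = reduce (u ++ w).
Proof. by move=> ev; rewrite -reduce_catr -(reduce_catl v) ev reduce_catr. Qed.

Lemma palindrome_reduce w : palindrome w -> palindrome (reduce w).
Proof. by move=> /eqP ew; rewrite /palindrome -reduce_rev -ew. Qed.

(** [C] is the maximal part of [p] that cancels. By induction on [p], a new first letter can cancel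
    only once [X] is empty, since [p] itself is reduced. *)
Lemma reduce_cat_cancel p q : reduced p -> reduced q ->
  exists X C Y, [/\ p = X ++ C, q = winv C ++ Y & reduce (p ++ q) = X ++ Y].
Proof.
move=> + rq; elim: p => [_|x p IHp rxp].
  by exists [::], [::], q; rewrite /= reduce_id.
have [[|y X] [C [Y [Ep Eq Er]]]] := IHp (reduced_behead rxp); last first.
  exists (x :: y :: X), C, Y; rewrite [reduce _]/= Er {1}Ep /=; split=> //.
  by move: rxp; rewrite Ep /= => /andP[/negPf->].
rewrite [reduce _]/= Er; move: Eq {Er}; rewrite {}Ep {p IHp rxp} /=.
case: Y => [|y Y] Eq; rewrite /push; first by exists [:: x], C, [::].
case: (y =P linv x) Eq => [->|_] Eq; last by exists [:: x], C, (y :: Y).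
by exists [::], (x :: C), Y; rewrite Eq winv_cons cat_rcons.
Qed.

(** The mirror image starts with [rev C], which fits inside [X]; stripping [rev C] and [C] from the
    two ends leaves a palindrome. *)
Lemma palindrome_catl X C : palindrome (X ++ C) -> size C <= size X ->
  exists2 P, X = rev C ++ P & palindrome P.
Proof.
rewrite /palindrome rev_cat -{1 2}(cat_take_drop (size C) X) => eXC sCX.
have := eXC; rewrite -catA eqseq_cat ?size_rev ?size_takel //.
case/andP=> /eqP eC; rewrite rev_cat eC revK eqseq_cat ?size_rev //.
by case/andP=> pP _; exists (drop (size C) X); rewrite // -eC cat_take_drop.
Qed.

Lemma palindrome_catr C X : palindrome (C ++ X) -> size C <= size X ->
  exists2 P, X = P ++ rev C & palindrome P.
Proof.
move=> pCX sCX; have [||P eX pP] := @palindrome_catl (rev X) (rev C).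
- by rewrite -rev_cat /palindrome revK eq_sym.
- by rewrite !size_rev.
exists P => //; move/eqP: pP => ->.
by rewrite -[LHS]revK eX revK rev_cat.
Qed.

(* When N is longer than Z, the word Z N = N (rev Z) has period Z: writing
   N = Z N', the shorter words N' and Z N' are palindromes again. *)
Lemma palindrome_quotient Z N : palindrome N -> palindrome (Z ++ N) ->
  exists P Q, [/\ palindrome P, palindrome Q & Z = P ++ Q].
Proof.
have [n] := ubnP (size N); elim: n N => // n IHn N ltNn pN pZN.
have [sNZ|sZN] := leqP (size N) (size Z).
  have [P eZ pP] := palindrome_catl pZN sNZ.
  by exists N, P; split; rewrite // {1}(eqP pN).
(* A nonempty [Z] makes [N'] strictly shorter than [N]. *)
have [->|Z0] := eqVneq Z [::]; first by exists [::], [::].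
have [N' eN pN'] := palindrome_catr pZN (ltnW sZN).
have eZN : N = Z ++ N' by rewrite (eqP pN) eN rev_cat revK -(eqP pN').
apply: (IHn N') => //; last by rewrite -eZN.
apply: leq_trans (_ : size N <= n); last by [].
by rewrite eZN size_cat -[X in X < _]add0n ltn_add2r lt0n size_eq0.
Qed.

Definition conj_two_palindromes w := exists A P Q,
  [/\ palindrome P, palindrome Q & w = A ++ P ++ Q ++ winv A].

(** Inversion keeps [A] and swaps the roles of [P] and [Q]; this lets the longer palindrome be taken
    as the left factor. *)
Lemma conj_two_palindromes_winv w :
  conj_two_palindromes w -> conj_two_palindromes (winv w).
Proof.
move=> [A [P [Q [pP pQ ->]]]]; exists A, (winv Q), (winv P).
by split; rewrite ?palindrome_winv // !winv_cat winvK -!catA.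
Qed.

Lemma reduce_cat_palindromes p q :
  reduced p -> reduced q -> palindrome p -> palindrome q ->
  size q <= size p -> conj_two_palindromes (reduce (p ++ q)).
Proof.
move=> rp rq + + ; have [X [C [Y [-> -> ->]]]] := reduce_cat_cancel rp rq.
rewrite !size_cat size_winv addnC leq_add2r => pp pq sYX.
have [sCY|sYC] := leqP (size C) (size Y).
  have [P -> pP] := palindrome_catl pp (leq_trans sCY sYX).
  have [|Q -> pQ] := palindrome_catr pq; first by rewrite size_winv.
  by exists (rev C), P, Q; rewrite winv_rev -!catA.
(* Here [winv C = rev Y ++ M], so [p] becomes [X ++ winv M ++ rev (winv Y)], whose outer ends are
   now stripped. *)
have [|M eC pM] := palindrome_catl pq; first by rewrite size_winv ltnW.
move: pp; rewrite -[C]winvK eC winv_cat catA => pp.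
have [|R eX pR] := palindrome_catl pp.
  by rewrite size_cat size_winv size_rev (leq_trans sYX) ?leq_addr.
(* Splitting [X] at [size Y] gives [X = winv Y ++ Z] with [Z ++ winv M = R] a palindrome. *)
move/eqP: eX; rewrite winv_rev revK -{1}(cat_take_drop (size Y) X) -catA.
rewrite eqseq_cat ?size_winv ?size_takel // => /andP[/eqP eX /eqP eR].
rewrite -eR in pR.
have [P [Q [pP pQ eZ]]] := palindrome_quotient (palindrome_winv pM) pR.
exists (winv Y), P, Q; split=> //.
by rewrite winvK -{1}(cat_take_drop (size Y) X) eX eZ -!catA.
Qed.

End Words.

Lemma mul_palindromic (Sigma : choiceType) (p q : free_group Sigma) :
  palindromic p -> palindromic q ->
  conj_two_palindromes (rform (p * q)%g).
Proof.
move=> pp pq; have [sqp|spq] := leqP (size (rform q)) (size (rform p)).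
  exact: reduce_cat_palindromes (rform_reduced _) (rform_reduced _) pp pq sqp.
rewrite -[(p * q)%g]invgK invMg; apply: conj_two_palindromes_winv.
apply: reduce_cat_palindromes; rewrite ?rform_reduced ?palindrome_winv //.
by rewrite /= !size_winv ltnW.
Qed.

Theorem theorem1 (Sigma : choiceType) (g : free_group Sigma) :
  (exists s : seq (free_group Sigma),
     [/\ (size s <= 2)%N, all (palindromic (Sigma:=Sigma)) s
       & g = (\prod_(p <- s) p)%g]) <->
  (exists A P Q : word Sigma,
     [/\ palindrome P, palindrome Q
       & rform g = A ++ P ++ Q ++ winv A]).
Proof.
split=> [[[|p [|q [|r s]]] [//= _ + ->]]|[A [P [Q [pP pQ eg]]]]].
- by rewrite big_nil; exists [::], [::], [::].
- rewrite andbT big_cons big_nil mulg1 => pp.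
  by exists [::], (rform p), [::]; rewrite /= cats0.
- rewrite andbT !big_cons big_nil mulg1 => /andP[pp pq].
  exact: mul_palindromic.
pose p := FreeGroup (reduce_reduced (A ++ P ++ rev A)).
pose q := FreeGroup (reduce_reduced (winv (rev A) ++ Q ++ winv A)).
exists [:: p; q]; split=> //=.
  rewrite /palindromic /= !palindrome_reduce ?palindrome_cat_rev //.
  by rewrite -[winv A]revK -winv_rev palindrome_cat_rev.
rewrite !big_cons big_nil mulg1; apply: val_inj => /=.
rewrite reduce_catl reduce_catr -[LHS]reduce_id ?rform_reduced // eg.
(* The inner factor [rev A ++ winv (rev A)] cancels. *)
have := reduce_cat_nil (A ++ P) (Q ++ winv A) (reduce_winvr (rev A)).
by rewrite -!catA.
Qed.
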